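(* Consider a multiply coupled PH-DAE with $k\ge 2$ subsystems in the dynamic iteration sense, with iteration index $l$. Set $v^\top=(v_1^\top,\dots,v_k^\top)$ for $v\in\{x,\hat u,\bar u,\hat y,\bar y\}$ (with the respective iteration superscripts), $F=\operatorname{diag}(F_1,\dots,F_k)$ for $F\in\{E,J,\hat B,\bar B\}$, $z(x)^\top=(z_1(x_1)^\top,\dots,z_k(x_k)^\top)$, $r(z(x))^\top=(r_1(z_1(x_1))^\top,\dots,r_k(z_k(x_k))^\top)$. (Jacobi) Under the Jacobi-type coupling $0=\hat u_i^{(l+1)}+\sum_{j\ne i}\hat C_{i,j}\hat y_j^{(l)}$ ($i=1,\dots,k$), the overall system is $$\frac{d}{dt}\begin{pmatrix}E&0&0\\0&0&0\\0&0&0\end{pmatrix}\begin{pmatrix}x^{(l+1)}\\ \hat u^{(l+1)}\\ \hat y^{(l+1)}\end{pmatrix}=\begin{pmatrix}J&\hat B&0\\-\hat B^\top&0&I\\0&-I&0\end{pmatrix}\begin{pmatrix}z(x^{(l+1)})\\ \hat u^{(l+1)}\\ \hat y^{(l+1)}\end{pmatrix}-\begin{pmatrix}r(z(x^{(l+1)}))\\0\\0\end{pmatrix}+\begin{pmatrix}\bar B&0\\0&0\\0&-\hat C\end{pmatrix}\begin{pmatrix}\bar u^{(l+1)}\\ \hat y^{(l)}\end{pmatrix},$$ with output $$y^{\mathrm{tot}}=\begin{pmatrix}\bar B^\top&0&0\\0&0&-\hat C^\top\end{pmatrix}\begin{pmatrix}z(x^{(l+1)})\\ \hat u^{(l+1)}\\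 \hat y^{(l+1)}\end{pmatrix},$$ and it is a PH-DAE $$\frac{d}{dt}E^{\mathrm{tot}}x^{\mathrm{tot}}=J^{\mathrm{tot}}z^{\mathrm{tot}}-r^{\mathrm{tot}}(z^{\mathrm{tot}})+B^{\mathrm{tot}}u^{\mathrm{tot}},\qquad y^{\mathrm{tot}}=(B^{\mathrm{tot}})^\top z^{\mathrm{tot}}$$ with $$x^{\mathrm{tot}}=\begin{pmatrix}x^{(l+1)}\\ \hat u^{(l+1)}\\ \hat y^{(l+1)}\end{pmatrix},\ z^{\mathrm{tot}}=\begin{pmatrix}z(x^{(l+1)})\\ \hat u^{(l+1)}\\ \hat y^{(l+1)}\end{pmatrix},\ r^{\mathrm{tot}}(z^{\mathrm{tot}})=\begin{pmatrix}r(z(x^{(l+1)}))\\0\\0\end{pmatrix},\ u^{\mathrm{tot}}=\begin{pmatrix}\bar u^{(l+1)}\\ \hat y^{(l)}\end{pmatrix},$$ $$E^{\mathrm{tot}}=\begin{pmatrix}E&0&0\\0&0&0\\0&0&0\end{pmatrix},\quad J^{\mathrm{tot}}=\begin{pmatrix}J&\hat B&0\\-\hat B^\top&0&I\\0&-I&0\end{pmatrix},\quad B^{\mathrm{tot}}=\begin{pmatrix}\bar B&0\\0&0\\0&-\hat C\end{pmatrix}.$$ (Gauss–Seidel) Under the Gauss–Seidel-type coupling $0=\hat u_i^{(l+1)}+\sum_{j=1}^{i-1}\hat C_{i,j}\hat y_j^{(l+1)}+\sum_{j=i+1}^{k}\hat C_{i,j}\hat y_j^{(l)}$ ($i=1,\dots,k$),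 written in short as $\hat u^{(l+1)}+\hat C_1\hat y^{(l)}+\hat C_2\hat y^{(l+1)}=0$, and provided that $\hat C$ is skew-symmetric, the overall system can be formulated as a PH-DAE of the same form, with the same $x^{\mathrm{tot}},z^{\mathrm{tot}},r^{\mathrm{tot}},E^{\mathrm{tot}}$, but with $$J^{\mathrm{tot}}=\begin{pmatrix}J&\hat B&0\\-\hat B^\top&0&I\\0&-I&-\hat C\end{pmatrix},\quad B^{\mathrm{tot}}=\begin{pmatrix}\bar B&0\\0&0\\0&\hat C_1\end{pmatrix},\quad u^{\mathrm{tot}}=\begin{pmatrix}\bar u^{(l+1)}\\ \Delta\hat y^{(l+1)}\end{pmatrix},\qquad \Delta\hat y^{(l+1)}=\hat y^{(l+1)}-\hat y^{(l)}.$$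
   Context: PH-DAE. A system $\frac{d}{dt}Ex(t)=Jz(x(t))-r(z(x(t)))+Bu(t)$, $y(t)=B^\top z(x(t))$ with $E\in\mathbb{R}^{p\times n}$, $J\in\mathbb{R}^{p\times p}$, $B\in\mathbb{R}^{p\times m}$, $z:\mathbb{R}^n\to\mathbb{R}^p$, $r:\mathbb{R}^p\to\mathbb{R}^p$ is a port-Hamiltonian DAE (PH-DAE) if there exist a subspace $\mathcal V\subset\mathbb{R}^p$ and $H\in C^1(\mathbb{R}^n,\mathbb{R})$ (the Hamiltonian) such that: (i) for all intervals $\mathcal I$ and all $u:\mathcal I\to\mathbb{R}^m$ for which the system has a solution $x:\mathcal I\to\mathbb{R}^n$, $z(x(t))\in\mathcal V$ for all $t\in\mathcal I$; (ii) $v^\top Jw=-w^\top Jv$ for all $v,w\in\mathcal V$; (iii) $v^\top r(v)\ge0$ for all $v\in\mathcal V$; (iv) $\nabla H(x)=E^\top z(x)$ for all $x\in z^{-1}(\mathcal V)$. A solution is a function $x$ with $Ex$ differentiable satisfying the equation pointwise. Multiply coupled PH-DAE, dynamic iteration sense. Given are $k$ PH-DAEs with data $E_i,J_i,z_i,r_i,B_i$, Hamiltonians $H_i$, and inputs/outputs split into coupling parts (hat, $\hat u_i,\hat y_i\in\mathbb{R}^{m_i}$) and external parts (bar), $B_i=(\hat B_i\ \bar B_i)$. In iteration $l+1$ the $i$th subsystem is $$\frac{d}{dt}E_ix_i^{(l+1)}=J_iz_i^{(l+1)}-r_i(z_i^{(l+1)})+\hat B_i\hat u_i^{(l+1)}+\bar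 B_i\bar u_i^{(l+1)},\quad \hat y_i^{(l+1)}=\hat B_i^\top z_i^{(l+1)},\quad \bar y_i^{(l+1)}=\bar B_i^\top z_i^{(l+1)},$$ with $z_i^{(l+1)}=z_i(x_i^{(l+1)})$. The coupling matrices satisfy $\hat C_{i,j}\in\{-1,0,1\}^{m_i\times m_j}$; $\hat C$ is the block matrix with off-diagonal blocks $\hat C_{i,j}$ and zero diagonal blocks. $\hat C$ itself is not assumed skew-symmetric, but $\hat B\hat C\hat B^\top$ is required to be skew-symmetric. The old iterate $\hat y^{(l)}$ (respectively $\Delta\hat y^{(l+1)}$) is regarded as an input of the overall system. $\hat C_1$ and $\hat C_2$ are the strictly upper and strictly lower block-triangular parts of $\hat C$, so $\hat C=\hat C_1+\hat C_2$. *)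

(* Defs.v *)
From HB Require Import structures.
From mathcomp Require Import all_boot all_order all_algebra.
From mathcomp Require Import all_classical all_reals all_analysis.

Set Implicit Arguments.
Unset Strict Implicit.
Unset Printing Implicit Defensive.
Import Order.TTheory GRing.Theory Num.Theory.
Import numFieldNormedType.Exports.
Local Open Scope classical_set_scope.
Local Open Scope ring_scope.

Section BlockMatrices.
Variable T : Type.

Definition col3 (a b c q : nat)
    (A : 'M[T]_(a, q)) (B : 'M[T]_(b, q)) (C : 'M[T]_(c, q)) :=
  col_mx A (col_mx B C).

Definition row3 (q a b c : nat)
    (A : 'M[T]_(q, a)) (B : 'M[T]_(q, b)) (C : 'M[T]_(q, c)) :=
  row_mx A (row_mx B C).

Definition block3 (a b c a' b' c' : nat)
    (A1 : 'M[T]_(a, a')) (B1 : 'M[T]_(a, b')) (C1 : 'M[T]_(a, c'))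
    (A2 : 'M[T]_(b, a')) (B2 : 'M[T]_(b, b')) (C2 : 'M[T]_(b, c'))
    (A3 : 'M[T]_(c, a')) (B3 : 'M[T]_(c, b')) (C3 : 'M[T]_(c, c')) :=
  col3 (row3 A1 B1 C1) (row3 A2 B2 C2) (row3 A3 B3 C3).

Definition block32 (a b c a' b' : nat)
    (A1 : 'M[T]_(a, a')) (B1 : 'M[T]_(a, b'))
    (A2 : 'M[T]_(b, a')) (B2 : 'M[T]_(b, b'))
    (A3 : 'M[T]_(c, a')) (B3 : 'M[T]_(c, b')) :=
  col3 (row_mx A1 B1) (row_mx A2 B2) (row_mx A3 B3).

Definition block23 (a b a' b' c' : nat)
    (A1 : 'M[T]_(a, a')) (B1 : 'M[T]_(a, b')) (C1 : 'M[T]_(a, c'))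
    (A2 : 'M[T]_(b, a')) (B2 : 'M[T]_(b, b')) (C2 : 'M[T]_(b, c')) :=
  col_mx (row3 A1 B1 C1) (row3 A2 B2 C2).

End BlockMatrices.

(* [mxdiag] only covers square blocks. On the diagonal the dimensions agree, so
   [conform_mx 0 (F i)] is [F i]. *)
Definition blkdiag (R : nmodType) (k : nat) (a b : 'I_k -> nat)
    (F : forall i, 'M[R]_(a i, b i)) : 'M[R]_(\sum_i a i, \sum_i b i) :=
  \mxblock_(i, j) (if i == j then conform_mx 0 (F i) else 0).

Definition stack (R : Type) (k : nat) (d : 'I_k -> nat)
    (v : forall i, R -> 'cV[R]_(d i)) (t : R) : 'cV[R]_(\sum_i d i) :=
  \mxcol_i v i t.

Section PHDAE.
Variable R : realType.

(* A degenerate interval is excluded: at an isolated time every vector would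
   count as a derivative. *)
Definition time_interval (I : set R) : Prop :=
  is_interval I /\ exists a b, [/\ I a, I b & a < b].

(* The derivative is taken relative to [I], hence is one-sided at an endpoint
   belonging to [I]; values of [f] outside [I] are irrelevant. *)
Definition has_deriv_on (I : set R) (d : nat) (f : R -> 'cV[R]_d) (t : R)
    (l : 'cV[R]_d) : Prop :=
  (s - t)^-1 *: (f s - f t) @[s --> within I t^'] --> l.

Definition gradient (n : nat) (H : 'cV[R]_n -> R) (x : 'cV[R]_n) : 'cV[R]_n :=
  \col_i 'D_(delta_mx i 0) H x.

Definition C1 (n : nat) (H : 'cV[R]_n -> R) : Prop :=
  (forall x, differentiable H x) /\ continuous (gradient H).

Record dae (n p m : nat) := Dae {
  dae_E : 'M[R]_(p, n);
  dae_J : 'M[R]_p;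
  dae_B : 'M[R]_(p, m);
  dae_z : 'cV[R]_n -> 'cV[R]_p;
  dae_r : 'cV[R]_p -> 'cV[R]_p }.

(* Functions on [I] are represented by functions on all of [R] of which only
   the values on [I] matter. *)
Definition solution (n p m : nat) (S : dae n p m) (I : set R)
    (u : R -> 'cV[R]_m) (x : R -> 'cV[R]_n) : Prop :=
  forall t, I t ->
    has_deriv_on I (fun s => dae_E S *m x s) t
      (dae_J S *m dae_z S (x t) - dae_r S (dae_z S (x t)) + dae_B S *m u t).

Definition trajectory (n p m : nat) (S : dae n p m) (I : set R)
    (u : R -> 'cV[R]_m) (x : R -> 'cV[R]_n) (y : R -> 'cV[R]_m) : Prop :=
  solution S I u x /\ (forall t, I t -> y t = (dae_B S)^T *m dae_z S (x t)).

Definition ph_dae (n p m : nat) (S : dae n p m) : Prop :=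
  exists (V : {vspace 'cV[R]_p}) (H : 'cV[R]_n -> R),
    C1 H /\
    [/\ (forall I u x, time_interval I -> solution S I u x ->
           forall t, I t -> dae_z S (x t) \in V),
        (forall v w, v \in V -> w \in V ->
           v^T *m dae_J S *m w = - (w^T *m dae_J S *m v)),
        (forall v, v \in V -> 0 <= (v^T *m dae_r S v) 0 0) &
        (forall x, dae_z S x \in V ->
           gradient H x = (dae_E S)^T *m dae_z S x)].

Record subsystem (n p mh mb : nat) := Subsystem {
  sub_E : 'M[R]_(p, n);
  sub_J : 'M[R]_p;
  sub_Bh : 'M[R]_(p, mh);
  sub_Bb : 'M[R]_(p, mb);
  sub_z : 'cV[R]_n -> 'cV[R]_p;
  sub_r : 'cV[R]_p -> 'cV[R]_p }.

Definition sub_dae (n p mh mb : nat) (S : subsystem n p mh mb) :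
    dae n p (mh + mb) :=
  Dae (sub_E S) (sub_J S) (row_mx (sub_Bh S) (sub_Bb S)) (sub_z S) (sub_r S).

Section Coupled.
Variables (k : nat) (n p mh mb : 'I_k -> nat).
Variable S : forall i, subsystem (n i) (p i) (mh i) (mb i).
Variable C : forall i j, 'M[R]_(mh i, mh j).

Definition coupling_mx : 'M[R]_(\sum_i mh i, \sum_i mh i) :=
  \mxblock_(i, j) (if i == j then 0 else C i j).

Definition coupling_upper : 'M[R]_(\sum_i mh i, \sum_i mh i) :=
  \mxblock_(i, j) (if (i < j)%N then C i j else 0).

Definition coupling_lower : 'M[R]_(\sum_i mh i, \sum_i mh i) :=
  \mxblock_(i, j) (if (j < i)%N then C i j else 0).

Definition big_z (x : 'cV[R]_(\sum_i n i)) : 'cV[R]_(\sum_i p i) :=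
  \mxcol_i sub_z (S i) (submxcol x i).

Definition big_r (w : 'cV[R]_(\sum_i p i)) : 'cV[R]_(\sum_i p i) :=
  \mxcol_i sub_r (S i) (submxcol w i).

Local Notation N := (\sum_i n i)%N.
Local Notation P := (\sum_i p i)%N.
Local Notation M := (\sum_i mh i)%N.

Definition ztot (X : 'cV[R]_(N + (M + M))) : 'cV[R]_(P + (M + M)) :=
  col3 (big_z (usubmx X)) (usubmx (dsubmx X)) (dsubmx (dsubmx X)).

Definition rtot (Z : 'cV[R]_(P + (M + M))) : 'cV[R]_(P + (M + M)) :=
  col3 (big_r (usubmx Z)) 0 0.

Lemma ztotE x uh yh : ztot (col3 x uh yh) = col3 (big_z x) uh yh.
Proof. by rewrite /ztot /col3 !(col_mxKu, col_mxKd). Qed.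

Lemma rtotE w uh yh : rtot (col3 w uh yh) = col3 (big_r w) 0 0.
Proof. by rewrite /rtot /col3 col_mxKu. Qed.

Definition subsystems_hold (I : set R)
    (x : forall i, R -> 'cV[R]_(n i))
    (uh : forall i, R -> 'cV[R]_(mh i)) (ub : forall i, R -> 'cV[R]_(mb i))
    (yh : forall i, R -> 'cV[R]_(mh i)) (yb : forall i, R -> 'cV[R]_(mb i)) :
    Prop :=
  forall i t, I t ->
    [/\ has_deriv_on I (fun s => sub_E (S i) *m x i s) t
          (sub_J (S i) *m sub_z (S i) (x i t) - sub_r (S i) (sub_z (S i) (x i t))
           + sub_Bh (S i) *m uh i t + sub_Bb (S i) *m ub i t),
        yh i t = (sub_Bh (S i))^T *m sub_z (S i) (x i t) &
        yb i t = (sub_Bb (S i))^T *m sub_z (S i) (x i t)].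

(* [yh0] is the old iterate and [uh] the new one. *)
Definition jacobi_coupling (I : set R)
    (uh yh0 : forall i, R -> 'cV[R]_(mh i)) : Prop :=
  forall i t, I t -> 0 = uh i t + \sum_(j | j != i) C i j *m yh0 j t.

(* [yh0] is the old iterate; [uh] and [yh] are the new ones. *)
Definition gauss_seidel_coupling (I : set R)
    (uh yh0 yh : forall i, R -> 'cV[R]_(mh i)) : Prop :=
  forall i t, I t ->
    0 = uh i t + \sum_(j : 'I_k | (j < i)%N) C i j *m yh j t
               + \sum_(j : 'I_k | (i < j)%N) C i j *m yh0 j t.

End Coupled.
End PHDAE.

(* Main.v *)
Require Import Defs.
From HB Require Import structures.
From mathcomp Require Import all_boot all_order all_algebra.
From mathcomp Require Import all_classical all_reals all_analysis.

Set Implicit Arguments.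
Unset Strict Implicit.
Unset Printing Implicit Defensive.
Import Order.TTheory GRing.Theory Num.Theory.
Import numFieldNormedType.Exports.
Local Open Scope classical_set_scope.
Local Open Scope ring_scope.

(* The third block row of the total system reads [0 = - uh - K yh + D w]. For
   Jacobi this is the coupling itself ([K = 0], [D = - Ch], [w] the old [yh]).
   For Gauss-Seidel, [Ch yh - Ch1 (yh - yh_old) = Ch2 yh + Ch1 yh_old] because
   [Ch = Ch1 + Ch2], so [K = Ch], [D = Ch1] and [w = yh - yh_old] works. The
   rows without derivative are recovered from [d/dt 0 = rhs], which forces
   [rhs = 0] since every time in the interval is a limit point of it. The
   Hamiltonian is the sum of the [H_i (x_i)], the subspace is the product of the
   [V_i] with the full space of the [(uh, yh)], and skewness of the total
   structure matrix only needs [K^T = - K]. *)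

(** * Block-diagonal matrices acting on stacked vectors *)

Section BlockDiagonal.
Variables (R : pzSemiRingType) (k : nat) (a b : 'I_k -> nat).
Implicit Type F : forall i, 'M[R]_(a i, b i).

Lemma tr_blkdiag F : (blkdiag F)^T = blkdiag (fun i => (F i)^T).
Proof.
rewrite /blkdiag tr_mxblock; apply: eq_mxblock => i j; rewrite eq_sym.
by case: eqVneq => [->|_]; rewrite ?trmx_conform trmx0.
Qed.

Lemma mul_blkdiag F q (v : 'M[R]_(\sum_i b i, q)) :
  blkdiag F *m v = \mxcol_i (F i *m submxcol v i).
Proof.
rewrite -{1}(submxcolK v) /blkdiag mul_mxblock_mxrow; apply: eq_mxcol => i.
rewrite (bigD1 i)//= eqxx conform_mx_id big1 ?addr0// => j.
by case: eqVneq => //=; rewrite mul0mx.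
Qed.

Lemma submxcol_blkdiag F q (v : 'M[R]_(\sum_i b i, q)) i :
  submxcol (blkdiag F *m v) i = F i *m submxcol v i.
Proof. by rewrite mul_blkdiag mxcolK. Qed.

(** This reduces skewness, dissipation and the gradient condition of the total system to sums over
    the subsystems. *)
Lemma tr_mul_mxcol (d : 'I_k -> nat) m q (u : 'M[R]_(\sum_i d i, m))
    (v : 'M[R]_(\sum_i d i, q)) :
  u^T *m v = \sum_i (submxcol u i)^T *m submxcol v i.
Proof. by rewrite -{1}(submxcolK u) -{1}(submxcolK v) tr_mxcol mul_mxrow_mxcol. Qed.

End BlockDiagonal.

(** * Products and transposes of three-block matrices *)

Section ThreeBlocks.
Variable R : pzSemiRingType.
Variables a b c a' b' c' : nat.

Lemma mul_block3_col3 (A1 : 'M[R]_(a, a')) (B1 : 'M[R]_(a, b')) C1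
    (A2 : 'M[R]_(b, a')) B2 C2 (A3 : 'M[R]_(c, a')) B3 (C3 : 'M[R]_(c, c'))
    q (u : 'M[R]_(a', q)) v w :
  block3 A1 B1 C1 A2 B2 C2 A3 B3 C3 *m col3 u v w =
  col3 (A1 *m u + B1 *m v + C1 *m w) (A2 *m u + B2 *m v + C2 *m w)
       (A3 *m u + B3 *m v + C3 *m w).
Proof. by rewrite /block3 /col3 /row3 !mul_col_mx !mul_row_col !addrA. Qed.

Lemma mul_block32_col (A1 : 'M[R]_(a, a')) (B1 : 'M[R]_(a, b'))
    (A2 : 'M[R]_(b, a')) B2 (A3 : 'M[R]_(c, a')) B3 q (u : 'M[R]_(a', q)) v :
  block32 A1 B1 A2 B2 A3 B3 *m col_mx u v =
  col3 (A1 *m u + B1 *m v) (A2 *m u + B2 *m v) (A3 *m u + B3 *m v).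
Proof. by rewrite /block32 /col3 !mul_col_mx !mul_row_col. Qed.

Lemma mul_block23_col3 (A1 : 'M[R]_(a, a')) (B1 : 'M[R]_(a, b')) C1
    (A2 : 'M[R]_(b, a')) B2 (C2 : 'M[R]_(b, c')) q (u : 'M[R]_(a', q)) v w :
  block23 A1 B1 C1 A2 B2 C2 *m col3 u v w =
  col_mx (A1 *m u + B1 *m v + C1 *m w) (A2 *m u + B2 *m v + C2 *m w).
Proof. by rewrite /block23 /col3 /row3 !mul_col_mx !mul_row_col !addrA. Qed.

Lemma tr_block32 (A1 : 'M[R]_(a, a')) (B1 : 'M[R]_(a, b'))
    (A2 : 'M[R]_(b, a')) B2 (A3 : 'M[R]_(c, a')) B3 :
  (block32 A1 B1 A2 B2 A3 B3)^T = block23 A1^T A2^T A3^T B1^T B2^T B3^T.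
Proof.
rewrite /block32 /block23 /col3 /row3 !tr_col_mx !tr_row_mx.
by do 2!rewrite -block_mxEh block_mxEv.
Qed.

Lemma tr_col3_mul m q (u : 'M[R]_(a, m)) (v : 'M[R]_(b, m)) (w : 'M[R]_(c, m))
    (u' : 'M[R]_(a, q)) v' w' :
  (col3 u v w)^T *m col3 u' v' w' = u^T *m u' + v^T *m v' + w^T *m w'.
Proof. by rewrite /col3 !tr_col_mx !mul_row_col addrA. Qed.

Lemma col3K q (X : 'M[R]_(a + (b + c), q)) :
  col3 (usubmx X) (usubmx (dsubmx X)) (dsubmx (dsubmx X)) = X.
Proof. by rewrite /col3 !vsubmxK. Qed.

End ThreeBlocks.

Lemma eq_tr_mul (R : pzSemiRingType) n (u v : 'cV[R]_n) :
  (forall w : 'cV[R]_n, u^T *m w = v^T *m w) -> u = v.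
Proof.
move=> uv; apply/colP => i; have /matrixP/(_ 0 0) := uv (delta_mx i 0).
by rewrite -!colE !mxE.
Qed.

(** * Limits of matrix-valued functions *)

Section MatrixLimits.
Variable R : realType.

Lemma cvg_mxP (T : Type) (F : set_system T) m n
    (f : T -> 'M[R]_(m, n)) (l : 'M[R]_(m, n)) :
  Filter F ->
  f @ F --> l <-> forall i j, f x i j @[x --> F] --> l i j.
Proof.
move=> FF; split=> [fl i j|fl A /=].
  by apply: (cvg_comp f (fun M : 'M[R]_(m, n) => M i j) fl);
     exact: coord_continuous.
(* A neighbourhood of [l] contains a box of entrywise neighbourhoods [P i j]; as there are finitely
   many entries, the filter is closed under the intersection over them. *)
move=> [P lP PA]; apply: (@filterS _ F FF (fun x => forall i j, P i j (f x i j))).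
  by move=> x Px; apply: PA.
by apply: filter_forall => i; apply: filter_forall => j; exact/fl/lP.
Qed.

Lemma rowsub_continuous m m' n (g : 'I_m' -> 'I_m) :
  continuous (rowsub g : 'M[R]_(m, n) -> 'M[R]_(m', n)).
Proof.
move=> M; apply/(cvg_mxP (rowsub g) _ (nbhs_filter M)) => i j.
rewrite [X in _ --> X]mxE.
under eq_fun do rewrite mxE.
exact: coord_continuous.
Qed.

End MatrixLimits.

(** * Derivatives relative to an interval *)

Section RelativeDerivative.
Variables (R : realType) (I : set R).

(** A nondegenerate interval has no isolated point, so limits of difference quotients along it are
    unique. *)
Lemma within_dnbhs_proper t :
  time_interval I -> I t -> ProperFilter (within I t^').
Proof.
move=> [Iitv [a [b [Ia Ib ab]]]] It.
apply: Build_ProperFilter_ex => P.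
rewrite /within /dnbhs /= => /nbhs_ballP[e /= e0 eP].
suff [s [Is st se]] : exists s, [/\ I s, s != t & `|t - s| < e].
  by exists s; apply: (eP s se).
have e2 : e / 2 < e by rewrite ltr_pdivrMr// ltr_pMr// ltr1n.
have e20 : 0 < e / 2 by rewrite divr_gt0.
have [tb|bt] := ltP t b.
  (* There is room to the right of [t]: capping by [b] keeps the point in [I] by convexity, and
     [e / 2] makes the distance strictly smaller than [e]. *)
  have ts : t < Num.min (t + e / 2) b by rewrite lt_min tb ltrDl e20.
  exists (Num.min (t + e / 2) b); split.
  - by apply: (Iitv t b) => //; rewrite (ltW ts) ge_min lexx orbT.
  - by rewrite gt_eqF.
  - rewrite distrC gtr0_norm ?subr_gt0// ltrBlDl.
    by rewrite (le_lt_trans (_ : _ <= t + e / 2)) ?ltrD2l// ge_min lexx.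
(* Otherwise [a < b <= t], and the mirrored choice to the left of [t] works. *)
have ta := lt_le_trans ab bt.
have ts : Num.max (t - e / 2) a < t by rewrite gt_max ta ltrBlDr ltrDl e20.
exists (Num.max (t - e / 2) a); split.
- by apply: (Iitv a t) => //; rewrite (ltW ts) le_max lexx orbT.
- by rewrite lt_eqF.
- rewrite gtr0_norm ?subr_gt0// ltrBlDr -ltrBlDl.
  by rewrite (lt_le_trans (_ : _ < t - e / 2)) ?ltrD2l ?ltrN2// le_max lexx.
Qed.

Lemma eq_has_deriv_on d (f g : R -> 'cV[R]_d) t (l : 'cV[R]_d) :
  f =1 g -> has_deriv_on I f t l -> has_deriv_on I g t l.
Proof. by move=> /funext ->. Qed.

Lemma has_deriv_onP d (f : R -> 'cV[R]_d) t (l : 'cV[R]_d) :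
  has_deriv_on I f t l <->
  forall i, (s - t)^-1 * (f s i 0 - f t i 0) @[s --> within I t^'] --> l i 0.
Proof.
have entry i : (fun s => ((s - t)^-1 *: (f s - f t)) i 0) =
               (fun s => (s - t)^-1 * (f s i 0 - f t i 0)).
  by apply/funext => s; rewrite !mxE.
split=> [/cvg_mxP fl i|fl]; first by rewrite -entry; exact: fl.
by apply/cvg_mxP => i j; rewrite ord1 entry; exact: fl.
Qed.

(** Extracting a block from [col_mx] or from [\mxcol] is a selection of rows, so this serves both
    splittings below. *)
Lemma has_deriv_on_rowsub d d' (g : 'I_d' -> 'I_d) (f : R -> 'cV[R]_d) t l :
  has_deriv_on I f t l ->
  has_deriv_on I (fun s => rowsub g (f s)) t (rowsub g l).
Proof.
move=> /has_deriv_onP fl; apply/has_deriv_onP => i.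
by rewrite !mxE; under eq_fun do rewrite mxE; exact: fl.
Qed.

Lemma has_deriv_on_col_mx d d' (f : R -> 'cV[R]_d) (g : R -> 'cV[R]_d') t l m :
  has_deriv_on I (fun s => col_mx (f s) (g s)) t (col_mx l m) <->
  has_deriv_on I f t l /\ has_deriv_on I g t m.
Proof.
split=> [fg|[/has_deriv_onP fl /has_deriv_onP gm]].
  split.
    move: (has_deriv_on_rowsub (g := lshift d') fg).
    by rewrite -usubmxEsub col_mxKu; apply: eq_has_deriv_on => s /=; rewrite col_mxKu.
  move: (has_deriv_on_rowsub (g := @rshift d d') fg).
  by rewrite -dsubmxEsub col_mxKd; apply: eq_has_deriv_on => s /=; rewrite col_mxKd.
apply/has_deriv_onP => i; case: (split_ordP i) => i' ->{i}.
  by rewrite !col_mxEu; under eq_fun do rewrite col_mxEu; exact: fl.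
by rewrite !col_mxEd; under eq_fun do rewrite col_mxEd; exact: gm.
Qed.

Lemma has_deriv_on_mxcol k (d : 'I_k -> nat) (f : forall i, R -> 'cV[R]_(d i))
    t (l : forall i, 'cV[R]_(d i)) :
  has_deriv_on I (fun s => \mxcol_i f i s) t (\mxcol_i l i) <->
  forall i, has_deriv_on I (f i) t (l i).
Proof.
split=> [fl i|fl].
  move: (has_deriv_on_rowsub (g := tagnat.Rank i) fl).
  rewrite -/(submxcol _ i) mxcolK.
  by apply: eq_has_deriv_on => s /=; rewrite -/(submxcol _ i) mxcolK.
apply/has_deriv_onP => j; rewrite !mxE; under eq_fun do rewrite mxE.
by have /has_deriv_onP := fl (tagnat.sig1 j); exact.
Qed.

(** The difference quotients vanish identically and limits along a proper filter are unique. This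
    turns the rows of the total system without derivative into algebraic equations. *)
Lemma has_deriv_on0 d t (l : 'cV[R]_d) : ProperFilter (within I t^') ->
  has_deriv_on I (fun=> 0) t l <-> l = 0.
Proof.
move=> PF; rewrite /has_deriv_on.
under eq_fun do rewrite subrr scaler0.
split=> [|->]; last exact: cvg_cst.
by move=> /cvg_lim <-//; rewrite lim_cst.
Qed.

End RelativeDerivative.

(** * Gradients and directional derivatives *)

Section Gradient.
Variable R : realType.

(** The differential is linear, so it suffices to expand [v] in the standard basis. *)
Lemma gradient_derive n (H : 'cV[R]_n -> R) x v : differentiable H x ->
  'D_v H x = ((gradient H x)^T *m v) 0 0.
Proof.
move=> dH; rewrite deriveE// {1}[v]matrix_sum_delta !mxE linear_sum/=.
apply: eq_bigr => i _; rewrite big_ord1 linearZ/= !mxE.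
by rewrite deriveE// mulrC.
Qed.

(** Testing against all directions identifies a gradient on a concatenated space without handling
    the indices of its basis vectors. *)
Lemma gradientP n (H : 'cV[R]_n -> R) x g : differentiable H x ->
  (forall v, 'D_v H x = (g^T *m v) 0 0) -> gradient H x = g.
Proof.
move=> dH gE; apply: eq_tr_mul => v; apply/matrixP => i j.
by rewrite !ord1 -gradient_derive// gE.
Qed.

Lemma differentiable_rowsub m n q (g : 'I_n -> 'I_m) (x : 'M[R]_(m, q)) :
  differentiable (rowsub g : 'M[R]_(m, q) -> 'M[R]_(n, q)) x.
Proof.
by apply: (@linear_differentiable _ _ _ (rowsub g)); exact: rowsub_continuous.
Qed.

(** As [rowsub g] is linear, the two difference quotients coincide before any limit is taken. *)
Lemma derive_rowsub m n (g : 'I_n -> 'I_m) (H : 'cV[R]_n -> R) (x v : 'cV[R]_m) :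
  'D_v (H \o rowsub g) x = 'D_(rowsub g v) H (rowsub g x).
Proof.
rewrite /derive; set f := (X in X @ _); set f' := (X in _ = lim (X @ _)).
suff -> : f = f' by [].
apply/funext => h; rewrite /f /f' /=.
suff -> : rowsub g (h *: v + x) = h *: rowsub g v + rowsub g x by [].
by apply/matrixP => i j; rewrite !mxE.
Qed.

End Gradient.

(** * The total system with parameters [K] and [D] *)

Section TotalSystem.
Variables (R : realType) (k : nat) (n p mh mb : 'I_k -> nat).
Variable S : forall i, subsystem R (n i) (p i) (mh i) (mb i).

Local Notation N := (\sum_i n i)%N.
Local Notation P := (\sum_i p i)%N.
Local Notation M := (\sum_i mh i)%N.
Local Notation E := (blkdiag (fun i => sub_E (S i))).
Local Notation J := (blkdiag (fun i => sub_J (S i))).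
Local Notation Bh := (blkdiag (fun i => sub_Bh (S i))).
Local Notation Bb := (blkdiag (fun i => sub_Bb (S i))).

(* Jacobi is the case [K = 0], [D = - Ch], and Gauss-Seidel the case [K = Ch],
   [D = Ch1]. *)
Definition total_dae (K D : 'M[R]_(M, M)) :=
  Dae (block3 E 0 0 0 (0 : 'M[R]_(M, M)) 0 0 0 (0 : 'M[R]_(M, M)))
      (block3 J Bh 0 (- Bh^T) 0 1%:M 0 (- 1%:M) (- K))
      (block32 Bb 0 0 0 0 D)
      (ztot S) (rtot (mh := mh) S).

(** The state is an arbitrary stacked function, cut by [submxcol], so that the equivalence also
    applies to the unknown solutions met in the invariance condition of [total_ph_dae]. *)
Lemma total_solutionP K D (I : set R) ub w x uh yh : time_interval I ->
  solution (total_dae K D) I (fun t => col_mx (ub t) (w t))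
    (fun t => col3 (x t) (uh t) (yh t)) <->
  forall t, I t ->
    [/\ forall i, has_deriv_on I (fun s => sub_E (S i) *m submxcol (x s) i) t
          (sub_J (S i) *m sub_z (S i) (submxcol (x t) i)
           - sub_r (S i) (sub_z (S i) (submxcol (x t) i))
           + sub_Bh (S i) *m submxcol (uh t) i
           + sub_Bb (S i) *m submxcol (ub t) i),
        yh t = Bh^T *m big_z S (x t) &
        uh t + K *m yh t - D *m w t = 0].
Proof.
move=> Iitv.
(* The two rows without derivative are merged into one zero block, to which [has_deriv_on0] applies
   at once. *)
have EtotE t : block3 E 0 0 0 (0 : 'M[R]_(M, M)) 0 0 0 (0 : 'M[R]_(M, M))
    *m col3 (x t) (uh t) (yh t) =
    col_mx (\mxcol_i (sub_E (S i) *m submxcol (x t) i)) 0.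
  rewrite mul_block3_col3 !mul0mx !addr0 /col3 col_mx0.
  by rewrite mul_blkdiag.
have rhsE t : dae_J (total_dae K D) *m dae_z (total_dae K D) (col3 (x t) (uh t) (yh t))
    - dae_r (total_dae K D) (dae_z (total_dae K D) (col3 (x t) (uh t) (yh t)))
    + dae_B (total_dae K D) *m col_mx (ub t) (w t) =
    col_mx (\mxcol_i (sub_J (S i) *m sub_z (S i) (submxcol (x t) i)
                      - sub_r (S i) (sub_z (S i) (submxcol (x t) i))
                      + sub_Bh (S i) *m submxcol (uh t) i
                      + sub_Bb (S i) *m submxcol (ub t) i))
      (col_mx (yh t - Bh^T *m big_z S (x t)) (- (uh t + K *m yh t - D *m w t))).
  rewrite /= ztotE rtotE mul_block3_col3 mul_block32_col /col3 !opp_col_mx !add_col_mx.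
  rewrite !mul0mx !mul1mx !mulNmx mul1mx !oppr0 !(addr0, add0r).
  congr (col_mx _ (col_mx _ _)); last by rewrite !opprD opprK.
    rewrite !mul_blkdiag /big_r /big_z -mxcolN -!mxcolD.
    by apply: eq_mxcol => i; rewrite !mxcolK; congr (_ + _); rewrite addrAC.
  by rewrite addrC.
split=> H t It; have PF := within_dnbhs_proper Iitv It.
  have := H t It; rewrite rhsE => /(eq_has_deriv_on EtotE).
  case/has_deriv_on_col_mx => /has_deriv_on_mxcol HE.
  rewrite has_deriv_on0 => /eqP; rewrite col_mx_eq0 subr_eq0 oppr_eq0.
  by move=> /andP[/eqP ? /eqP ?].
have [HE yhE uhE] := H t It.
rewrite rhsE; apply: (eq_has_deriv_on (fun s => esym (EtotE s))).
apply/has_deriv_on_col_mx; split; first exact/has_deriv_on_mxcol.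
by apply/has_deriv_on0; rewrite uhE yhE subrr oppr0 col_mx0.
Qed.

Lemma total_outputP K D (yb : 'cV[R]_(\sum_i mb i)) (z : 'cV[R]_P)
    (w uh yh : 'cV[R]_M) :
  col_mx yb w = (dae_B (total_dae K D))^T *m col3 z uh yh <->
  yb = Bb^T *m z /\ w = D^T *m yh.
Proof.
rewrite /= tr_block32 mul_block23_col3 !trmx0 !mul0mx !addr0 !add0r.
by split=> [/eq_col_mx|[-> ->]].
Qed.

Lemma total_ph_dae K D : K^T = - K -> (forall i, ph_dae (sub_dae (S i))) ->
  ph_dae (total_dae K D).
Proof.
move=> Kskew /(_ _)/cid phS.
(* Choice turns the existence statements for the subsystems into families of subspaces and
   Hamiltonians. *)
pose V i := projT1 (phS i).
have phV i := cid (projT2 (phS i)).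
pose H i := projT1 (phV i).
have phH i := projT2 (phV i).
(* [gx i] and [gz i] locate the rows of subsystem [i] in the total vectors; selecting these rows is
   the linear projection onto its component. *)
pose gx i (a : 'I_(n i)) : 'I_(N + (M + M)) := lshift (M + M) (tagnat.Rank i a).
pose gz i (a : 'I_(p i)) : 'I_(P + (M + M)) := lshift (M + M) (tagnat.Rank i a).
have gxE i q (X : 'M[R]_(_, q)) : rowsub (gx i) X = submxcol (usubmx X) i.
  by apply/matrixP => a b; rewrite !mxE.
have gzE i q (X : 'M[R]_(_, q)) : rowsub (gz i) X = submxcol (usubmx X) i.
  by apply/matrixP => a b; rewrite !mxE.
(* The product subspace is encoded as an intersection of preimages under the projections, which
   leaves the last two blocks free. *)
pose Vtot := (\bigcap_i (linfun (rowsub (gz i) : 'cV[R]_(_) -> 'cV[R]_(_)) @^-1: V i))%VS.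
have VtotP X : X \in Vtot <-> forall i, submxcol (usubmx X) i \in V i.
  rewrite memvE; split=> [/subv_bigcapP XV i|XV].
    by have := XV i isT; rewrite -memvE -memv_preim lfunE/= gzE.
  by apply/subv_bigcapP => i _; rewrite -memvE -memv_preim lfunE/= gzE.
have zV X i : ztot S X \in Vtot -> sub_z (S i) (submxcol (usubmx X) i) \in V i.
  by move=> /VtotP/(_ i); rewrite /ztot /col3 col_mxKu mxcolK.
pose Htot X := \sum_i (H i \o rowsub (gx i)) X.
have HtotE : Htot = \sum_i (H i \o rowsub (gx i)).
  by apply/funext => X; rewrite fct_sumE.
have dHi i X : differentiable (H i \o rowsub (gx i)) X.
  apply: differentiable_comp; first exact: differentiable_rowsub.
  by have [[]] := phH i.
have dH X : differentiable Htot X by rewrite HtotE; exact: differentiable_sum.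
(* [Htot] depends on [x] alone, hence the zero block for [uh] and [yh]. *)
have gradH X : gradient Htot X =
    col_mx (\mxcol_i gradient (H i) (submxcol (usubmx X) i)) 0.
  apply: gradientP => // v.
  rewrite HtotE derive_sum; last by move=> i; exact/diff_derivable.
  rewrite -{2}(vsubmxK v) tr_col_mx mul_row_col trmx0 mul0mx addr0.
  rewrite tr_mul_mxcol summxE; apply: eq_bigr => i _.
  rewrite derive_rowsub gradient_derive ?mxcolK ?gxE//.
  by have [[]] := phH i.
exists Vtot, Htot; split; first split=> //.
  (* Each entry of the gradient is either constantly zero or a projection followed by some
     [gradient (H i)] and a coordinate map. *)
  move=> X; apply/(cvg_mxP (gradient Htot) _ (nbhs_filter X)) => i j.
  suff : continuous (fun Y => gradient Htot Y i j) by exact.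
  case: (split_ordP i) => a ->{i}; last first.
    have Hd Y : gradient Htot Y (rshift _ a) j = 0 by rewrite gradH col_mxEd mxE.
    by rewrite (funext Hd); exact: cst_continuous.
  have Hu Y : gradient Htot Y (lshift _ a) j =
      gradient (H (tagnat.sig1 a)) (rowsub (gx (tagnat.sig1 a)) Y) (tagnat.sig2 a) j.
    by rewrite gradH col_mxEu mxE gxE.
  rewrite (funext Hu) => {}X; have [[_ gradHi] _] := phH (tagnat.sig1 a).
  apply: (@continuous_comp _ _ _
    (rowsub (gx (tagnat.sig1 a)) : 'cV[R]_(_) -> 'cV[R]_(_))
    (fun Y => gradient (H _) Y (tagnat.sig2 a) j)); first exact: rowsub_continuous.
  apply: (@continuous_comp _ _ _ (gradient (H (tagnat.sig1 a)))
    (fun Y => Y (tagnat.sig2 a) j)); first exact: gradHi.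
  exact: coord_continuous.
split.
- move=> I u X Iitv Xsol t It; apply/VtotP => i.
  rewrite /= /ztot /col3 col_mxKu mxcolK.
  have [_ [solV _ _ _]] := phH i.
  (* The state of subsystem [i] solves its own equation once its coupling input is read off the
     total state and its external input off the total input. *)
  apply: (solV I (fun s => col_mx (submxcol (usubmx (dsubmx (X s))) i)
                                  (submxcol (usubmx (u s)) i))
              (fun s => submxcol (usubmx (X s)) i) Iitv _ t It) => s Is /=.
  rewrite mul_row_col addrA.
  have /(total_solutionP _ _ _ _ _ _ _ Iitv)/(_ s Is)[] : solution (total_dae K D) I
      (fun t => col_mx (usubmx (u t)) (dsubmx (u t)))
      (fun t => col3 (usubmx (X t)) (usubmx (dsubmx (X t))) (dsubmx (dsubmx (X t)))).
    rewrite (_ : (fun t => col_mx _ _) = u); last by apply/funext => ?; rewrite vsubmxK.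
    by rewrite (_ : (fun t => col3 _ _ _) = X)//; apply/funext => ?; rewrite col3K.
  by move=> /(_ i).
- move=> v w /VtotP vV /VtotP wV /=.
  (* All terms are 1 by 1 matrices, so each may be transposed. This pairs [Bh] with [- Bh^T] and
     [1%:M] with [- 1%:M]; the diagonal blocks use skewness of each [sub_J (S i)] on [V i] and of
     [K]. *)
  have tr11 (X : 'M[R]_1) : X^T = X by apply/matrixP => r s; rewrite mxE !ord1.
  have skewJ : (usubmx w)^T *m (J *m usubmx v) = - ((usubmx v)^T *m (J *m usubmx w)).
    rewrite !tr_mul_mxcol -sumrN; apply: eq_bigr => i _.
    rewrite !submxcol_blkdiag !mulmxA.
    by have [_ [_ Jskew _ _]] := phH i; exact: Jskew (wV i) (vV i).
  have swap q q' (F : 'M[R]_(q, q')) (g : 'cV[R]_q) (h : 'cV[R]_q') :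
      g^T *m (F *m h) = h^T *m (F^T *m g).
    by rewrite -[LHS]tr11 !trmx_mul trmxK mulmxA.
  have skewK (g h : 'cV[R]_M) : g^T *m (K *m h) = - (h^T *m (K *m g)).
    by rewrite swap Kskew mulNmx mulmxN.
  rewrite -(col3K v) -(col3K w) -!mulmxA !mul_block3_col3 !tr_col3_mul.
  rewrite !mul0mx !addr0 ?add0r !mulNmx !mul1mx !mulmxDr !mulmxN.
  rewrite skewJ (swap _ _ Bh (usubmx w)) (swap _ _ Bh (usubmx v)).
  have dotC (g h : 'cV[R]_M) : g^T *m h = h^T *m g.
    by rewrite -[LHS]tr11 trmx_mul trmxK.
  rewrite (skewK (dsubmx (dsubmx w))) (dotC (dsubmx (dsubmx v))).
  rewrite (dotC (dsubmx (dsubmx w))) !opprD !opprK.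
  by rewrite [X in X + _ = _]addrACA -[LHS]addrA [X in _ + X = _]addrACA [LHS]addrA.
- move=> v /VtotP vV /=.
  rewrite -{1}(col3K v) /rtot tr_col3_mul !mulmx0 !addr0 tr_mul_mxcol summxE.
  apply: sumr_ge0 => i _; rewrite mxcolK.
  by have [_ [_ _ r_ge0 _]] := phH i; exact: r_ge0 _ (vV i).
- move=> X /zV XV; rewrite gradH /=.
  (* Testing against [w] moves the total [E] onto [w], where only its first block acts. *)
  apply: eq_tr_mul => w; rewrite trmx_mul trmxK -mulmxA.
  rewrite -(col3K w) mul_block3_col3 /ztot tr_col3_mul !mul0mx !addr0 !mulmx0 !addr0.
  rewrite /col3 tr_col_mx mul_row_col trmx0 mul0mx addr0 !tr_mul_mxcol.
  apply: eq_bigr => i _; rewrite !mxcolK submxcol_blkdiag mulmxA.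
  have [_ [_ _ _ gradHi]] := phH i.
  by rewrite gradHi ?XV//= trmx_mul trmxK.
Qed.

Lemma tr_blkdiag_big_z (d : 'I_k -> nat) (F : forall i, 'M[R]_(p i, d i))
    (x : forall i, R -> 'cV[R]_(n i)) t :
  (blkdiag F)^T *m big_z S (stack x t) =
  \mxcol_i ((F i)^T *m sub_z (S i) (x i t)).
Proof.
rewrite tr_blkdiag mul_blkdiag; apply: eq_mxcol => i.
by rewrite /big_z /stack !mxcolK.
Qed.

(** The second output block is prescribed as [D^T *m stack yh t], so its equation is an identity,
    while [yh] itself is determined by the second row of the dynamics. *)
Lemma total_trajectoryP K D (I : set R) x uh ub yh yb (w : R -> 'cV[R]_M) :
  time_interval I ->
  trajectory (total_dae K D) I (fun t => col_mx (stack ub t) (w t))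
    (fun t => col3 (stack x t) (stack uh t) (stack yh t))
    (fun t => col_mx (stack yb t) (D^T *m stack yh t)) <->
  subsystems_hold S I x uh ub yh yb /\
  forall t, I t -> stack uh t + K *m stack yh t - D *m w t = 0.
Proof.
move=> Iitv; split.
  move=> [/(total_solutionP _ _ _ _ _ _ _ Iitv) sol out].
  split=> [i t It|t It]; last by have [] := sol t It.
  have [/(_ i) HE yhE _] := sol t It.
  have := out t It; rewrite /= ztotE => /(total_outputP K)[ybE _].
  move: yhE ybE; rewrite !tr_blkdiag_big_z /stack => /eq_mxcolP yhE /eq_mxcolP ybE.
  split=> //; move: HE; rewrite /stack !mxcolK; apply: eq_has_deriv_on => s.
  by rewrite mxcolK.
move=> [sub coupling]; split.
  apply/(total_solutionP _ _ _ _ _ _ _ Iitv) => t It; split.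
  - move=> i; have [+ _ _] := sub i t It.
    rewrite /stack !mxcolK; apply: eq_has_deriv_on => s.
    by rewrite mxcolK.
  - by rewrite tr_blkdiag_big_z; apply: eq_mxcol => i; have [] := sub i t It.
  - exact: coupling.
move=> t It; rewrite /= ztotE; apply/(total_outputP K); split=> //.
by rewrite tr_blkdiag_big_z; apply: eq_mxcol => i; have [] := sub i t It.
Qed.

End TotalSystem.

(** * Coupling conditions in matrix form *)

Section Coupling.
Variables (R : realType) (k : nat) (mh : 'I_k -> nat).
Variable C : forall i j : 'I_k, 'M[R]_(mh i, mh j).
Implicit Types (I : set R) (u y : forall i, R -> 'cV[R]_(mh i)).

Lemma coupling_mxE : coupling_mx C = coupling_upper C + coupling_lower C.
Proof.
rewrite /coupling_mx /coupling_upper /coupling_lower -mxblockD.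
apply: eq_mxblock => i j; rewrite -val_eqE.
by case: ltngtP => _; rewrite ?addr0 ?add0r.
Qed.

(** The predicate [P] covers the index sets [j != i], [i < j] and [j < i] in one computation. *)
Lemma mul_mxblock_if_stack (P : 'I_k -> 'I_k -> bool) y t :
  \mxblock_(i, j) (if P i j then C i j else 0) *m stack y t =
  \mxcol_i \sum_(j | P i j) C i j *m y j t.
Proof.
rewrite /stack mul_mxblock_mxrow; apply: eq_mxcol => i.
rewrite [RHS]big_mkcond/=; apply: eq_bigr => j _.
by case: ifP; rewrite ?mul0mx.
Qed.

Lemma jacobi_couplingP I u y :
  jacobi_coupling C I u y <->
  forall t, I t -> stack u t + coupling_mx C *m stack y t = 0.
Proof.
(* The test is flipped to match the index condition of the coupling sum. *)
have -> : coupling_mx C = \mxblock_(i, j) (if j != i then C i j else 0).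
  by apply: eq_mxblock => i j; rewrite eq_sym; case: eqP.
split=> [cpl t It|cpl i t It].
  rewrite mul_mxblock_if_stack -mxcolD -[RHS]mxcol0.
  by apply: eq_mxcol => i; rewrite -cpl.
move: (cpl t It); rewrite mul_mxblock_if_stack -mxcolD -[RHS]mxcol0.
by move=> /eq_mxcolP/(_ i) ->.
Qed.

Lemma gauss_seidel_couplingP I u (y0 : forall i, R -> 'cV[R]_(mh i)) y :
  gauss_seidel_coupling C I u y0 y <->
  forall t, I t -> stack u t + coupling_upper C *m stack y0 t
                   + coupling_lower C *m stack y t = 0.
Proof.
split=> [cpl t It|cpl i t It].
  rewrite /coupling_upper /coupling_lower.
  rewrite !(mul_mxblock_if_stack (fun i j : 'I_k => _)) -!mxcolD -[RHS]mxcol0.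
  by apply: eq_mxcol => i; rewrite addrAC -cpl.
move: (cpl t It); rewrite /coupling_upper /coupling_lower.
rewrite !(mul_mxblock_if_stack (fun i j : 'I_k => _)) -!mxcolD -[RHS]mxcol0.
by move=> /eq_mxcolP/(_ i) eq0; rewrite addrAC eq0.
Qed.

End Coupling.

(** * Specialisation to the Jacobi and Gauss-Seidel schemes *)

Theorem corollary24 (R : realType) (k : nat) (n p mh mb : 'I_k -> nat)
    (S : forall i, subsystem R (n i) (p i) (mh i) (mb i))
    (C : forall i j : 'I_k, 'M[R]_(mh i, mh j))
    (x : nat -> forall i, R -> 'cV[R]_(n i))
    (uh : nat -> forall i, R -> 'cV[R]_(mh i))
    (ub : nat -> forall i, R -> 'cV[R]_(mb i))
    (yh : nat -> forall i, R -> 'cV[R]_(mh i))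
    (yb : nat -> forall i, R -> 'cV[R]_(mb i)) :
  let E := blkdiag (fun i => sub_E (S i)) in
  let J := blkdiag (fun i => sub_J (S i)) in
  let Bh := blkdiag (fun i => sub_Bh (S i)) in
  let Bb := blkdiag (fun i => sub_Bb (S i)) in
  let Ch := coupling_mx C in
  let Ch1 := coupling_upper C in
  let Ch2 := coupling_lower C in
  let Etot := block3 E 0 0
                     0 (0 : 'M[R]_(\sum_i mh i, \sum_i mh i)) 0
                     0 0 (0 : 'M[R]_(\sum_i mh i, \sum_i mh i)) in
  let xtot l t := col3 (stack (x l.+1) t) (stack (uh l.+1) t)
                       (stack (yh l.+1) t) in
  let Jjac := block3 J         Bh        0
                     (- Bh^T)  0         1%:M
                     0         (- 1%:M)  0 in
  let Bjac := block32 Bb 0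
                      0  0
                      0  (- Ch) in
  let Sjac := Dae Etot Jjac Bjac (ztot S) (rtot (mh := mh) S) in
  let ujac l t := col_mx (stack (ub l.+1) t) (stack (yh l) t) in
  let yjac l t := col_mx (stack (yb l.+1) t)
                         (- Ch^T *m stack (yh l.+1) t) in
  let Jgs := block3 J         Bh        0
                    (- Bh^T)  0         1%:M
                    0         (- 1%:M)  (- Ch) in
  let Bgs := block32 Bb 0
                     0  0
                     0  Ch1 in
  let Sgs := Dae Etot Jgs Bgs (ztot S) (rtot (mh := mh) S) in
  let ugs l t := col_mx (stack (ub l.+1) t)
                        (stack (yh l.+1) t - stack (yh l) t) in
  let ygs l t := col_mx (stack (yb l.+1) t)
                        (Ch1^T *m stack (yh l.+1) t) in
  (1 < k)%N ->
  (forall i, ph_dae (sub_dae (S i))) ->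
  (forall i j, i != j -> forall a b, C i j a b \in [:: -1; 0; 1]) ->
  (Bh *m Ch *m Bh^T)^T = - (Bh *m Ch *m Bh^T) ->
  [/\
    [/\ (forall (l : nat) (I : set R), time_interval I ->
           (subsystems_hold S I (x l.+1) (uh l.+1) (ub l.+1) (yh l.+1) (yb l.+1)
            /\ jacobi_coupling C I (uh l.+1) (yh l))
           <-> trajectory Sjac I (ujac l) (xtot l) (yjac l)),
        Bjac^T = block23 Bb^T 0 0
                         0    0 (- Ch^T) &
        ph_dae Sjac],
    Ch = Ch1 + Ch2,
    (forall (l : nat) (I : set R),
       gauss_seidel_coupling C I (uh l.+1) (yh l) (yh l.+1)
       <-> (forall t, I t ->
              stack (uh l.+1) t + Ch1 *m stack (yh l) t
              + Ch2 *m stack (yh l.+1) t = 0)) &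
    (Ch^T = - Ch ->
       (forall (l : nat) (I : set R), time_interval I ->
          (subsystems_hold S I (x l.+1) (uh l.+1) (ub l.+1) (yh l.+1) (yb l.+1)
           /\ gauss_seidel_coupling C I (uh l.+1) (yh l) (yh l.+1))
          <-> trajectory Sgs I (ugs l) (xtot l) (ygs l))
       /\ ph_dae Sgs)].
Proof.
move=> E J Bh Bb Ch Ch1 Ch2 Etot xtot Jjac Bjac Sjac ujac yjac Jgs Bgs Sgs ugs ygs.
move=> _ phS _ _.
have ChE : Ch = Ch1 + Ch2 by exact: coupling_mxE.
have SjacE : Sjac = total_dae S 0 (- Ch) by rewrite /total_dae oppr0.
have gsP l I : gauss_seidel_coupling C I (uh l.+1) (yh l) (yh l.+1) <->
    (forall t, I t -> stack (uh l.+1) t + Ch1 *m stack (yh l) t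
                      + Ch2 *m stack (yh l.+1) t = 0).
  exact: gauss_seidel_couplingP.
split=> //.
  split.
  (* Reading [- Ch^T] as [(- Ch)^T] gives the output the form [D^T *m stack yh t] with
     [D = - Ch]. *)
  - move=> l I Iitv; rewrite SjacE /ujac /xtot /yjac -linearN.
    rewrite total_trajectoryP// jacobi_couplingP.
    by split=> -[? cpl]; split=> // t /cpl; rewrite mul0mx addr0 mulNmx opprK.
  - by rewrite tr_block32 !trmx0 linearN.
  - by rewrite SjacE; apply: total_ph_dae => //; rewrite trmx0 oppr0.
(* Here [K = Ch], so skewness of [Ch] is exactly the condition on [K]. *)
move=> Chskew; split; last exact: total_ph_dae.
move=> l I Iitv; rewrite [trajectory _ _ _ _ _]total_trajectoryP// gsP.
have cplE t : stack (uh l.+1) t + Ch *m stack (yh l.+1) t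
    - Ch1 *m (stack (yh l.+1) t - stack (yh l) t) =
    stack (uh l.+1) t + Ch1 *m stack (yh l) t + Ch2 *m stack (yh l.+1) t.
  rewrite ChE mulmxDl mulmxBr opprB -addrA [_ *m _ + _ *m _]addrC.
  by rewrite addrACA subrr addr0 addrA addrAC.
by split=> -[? cpl]; split=> // t /cpl; rewrite cplE.
Qed.
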